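(* Let $J:\mathbb{R}^n\to[0,\infty)$ be convex, lower semicontinuous and absolutely one-homogeneous, and let $f\in\mathbb{R}^n$. Then $$ f = P_0(f) + \int_0^\infty \phi_{VM}(t)\,dt, $$ where the integral denotes the vector in $\mathbb{R}^n$ whose inner product with any $g\in\mathbb{R}^n$ is the value of the functional $\phi_{VM}$ at the constant test function $v\equiv g$.
   Context: $\langle\cdot,\cdot\rangle$ (also written $\cdot$) and $\|\cdot\|$ are the Euclidean inner product and norm on $\mathbb{R}^n$. Absolutely one-homogeneous means $J(su)=|s|J(u)$ for all $s\in\mathbb{R}$, $u\in\mathbb{R}^n$. The nullspace $\mathcal{N}(J)=\{u: J(u)=0\}$ is a linear subspace, and $P_0$ is the orthogonal projection onto it. For $t>0$, $u_{VM}(t)$ is the unique minimizer over $u\in\mathbb{R}^n$ of $\frac12\|u-f\|^2+tJ(u)$, and $u_{VM}(0)=f$; the map $t\mapsto u_{VM}(t)$ is Lipschitz and constant for large $t$. The spectral (wavelength) representation $\phi_{VM}(t)=t\,\partial_{tt}u_{VM}(t)$ is understood as the linear functional on test functions $v\in W^{1,1}_{loc}([0,\infty);\mathbb{R}^n)$ given by $$ v\mapsto \int_0^\infty v(t)\cdot\phi_{VM}(t)\,dt := -\int_0^\infty \big(t\,\partial_t v(t)+v(t)\big)\cdot\partial_t u_{VM}(t)\,dt. $$ *)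

(* Defs.v *)
From HB Require Import structures.
From mathcomp Require Import all_boot all_order all_algebra.
From mathcomp Require Import all_classical all_reals all_analysis.
From mathcomp Require Import measurable_realfun.

Set Implicit Arguments.
Unset Strict Implicit.
Unset Printing Implicit Defensive.
Import Order.TTheory GRing.Theory Num.Theory.
Import numFieldNormedType.Exports.
Local Open Scope ring_scope.
Local Open Scope classical_set_scope.

(* The library norm on 'rV[R]_n is the sup norm, hence the explicit Euclidean
   inner product and norm; the two norms induce the same topology. *)
Definition dotv (R : realType) (n : nat) (u v : 'rV[R]_n) : R :=
  \sum_(i < n) u 0 i * v 0 i.

Definition enorm (R : realType) (n : nat) (u : 'rV[R]_n) : R :=
  Num.sqrt (dotv u u).

Definition abs_one_homogeneous (R : realType) (n : nat)
    (J : 'rV[R]_n -> R) : Prop :=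
  forall (s : R) (u : 'rV[R]_n), J (s *: u) = `|s| * J u.

Definition nullspace (R : realType) (n : nat) (J : 'rV[R]_n -> R)
    : set 'rV[R]_n := [set u | J u = 0].

(* Meaningful when N is a linear subspace: the set below is then a singleton. *)
Definition orth_proj (R : realType) (n : nat) (N : set 'rV[R]_n)
    (f : 'rV[R]_n) : 'rV[R]_n :=
  xget 0 [set p | N p /\ forall w, N w -> dotv (f - p) w = 0].

Definition P0 (R : realType) (n : nat) (J : 'rV[R]_n -> R)
    (f : 'rV[R]_n) : 'rV[R]_n := orth_proj (nullspace J) f.

Definition VM_energy (R : realType) (n : nat) (J : 'rV[R]_n -> R)
    (f : 'rV[R]_n) (t : R) (u : 'rV[R]_n) : R :=
  2^-1 * enorm (u - f) ^+ 2 + t * J u.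

(* Values at t < 0 are irrelevant and set to f; for t > 0 the set of minimizers
   is a singleton whenever J is nonnegative, convex and lower semicontinuous. *)
Definition u_VM (R : realType) (n : nat) (J : 'rV[R]_n -> R)
    (f : 'rV[R]_n) (t : R) : 'rV[R]_n :=
  if 0 < t then
    xget 0 [set u | forall w, VM_energy J f t u <= VM_energy J f t w]
  else f.

Definition smooth_compact_pos (R : realType) (phi : R -> R) : Prop :=
  (forall (k : nat) (x : R), derivable (phi^`(k)) x 1) /\
  (exists a b : R, 0 < a /\ forall x : R, x < a \/ b < x -> phi x = 0).

Definition loc_integrable0y (R : realType) (n : nat) (v : R -> 'rV[R]_n)
    : Prop :=
  forall (T : R) (i : 'I_n),
    (@lebesgue_measure R).-integrable `[0, T] (EFin \o (fun t => v t 0 i)).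

Definition weak_derivative (R : realType) (n : nat)
    (v dv : R -> 'rV[R]_n) : Prop :=
  forall phi : R -> R, smooth_compact_pos phi -> forall i : 'I_n,
    (\int[@lebesgue_measure R]_(t in `[0%R, +oo[) (v t 0 i * phi^`()%classic t)%:E =
     - \int[@lebesgue_measure R]_(t in `[0%R, +oo[) (dv t 0 i * phi t)%:E)%E.

(* An element of W^{1,1}_loc([0,oo); R^n), carried together with a
   representative of its (a.e. unique) weak derivative; only the values at
   t >= 0 are meaningful. *)
Record W11loc (R : realType) (n : nat) := MkW11loc {
  W11_fun : R -> 'rV[R]_n ;
  W11_der : R -> 'rV[R]_n ;
  W11_fun_int : loc_integrable0y W11_fun ;
  W11_der_int : loc_integrable0y W11_der ;
  W11_weak : weak_derivative W11_fun W11_der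
}.

(* The derivative of u_VM is the pointwise one, which exists a.e. because u_VM
   is Lipschitz on [0,oo).  The value is an extended real, so that equating it
   to a real number includes the convergence of the integral. *)
Definition phi_VM (R : realType) (n : nat) (J : 'rV[R]_n -> R)
    (f : 'rV[R]_n) (v : W11loc R n) : \bar R :=
  (- \int[@lebesgue_measure R]_(t in `[0%R, +oo[)
     (dotv (t *: W11_der v t + W11_fun v t) ((u_VM J f)^`()%classic t))%:E)%E.

Section cst_test_function.
Variables (R : realType) (n : nat).

Let loc_integrable_cst (g : 'rV[R]_n) : loc_integrable0y (fun _ : R => g).
Proof.
move=> T i.
have -> : EFin \o (fun _ : R => g 0 i) = EFin \o cst (g 0 i) by [].
apply: continuous_compact_integrable; first exact: segment_compact.
by apply: continuous_subspaceT => x; exact: cvg_cst.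
Qed.

Let weak_derivative_cst (g : 'rV[R]_n) :
  weak_derivative (fun _ : R => g) (fun=> 0).
Proof.
move=> phi [dphi [a [b [a0 phi0]]]] i.
rewrite [in RHS]integral0_eq; last by move=> t _; rewrite mxE mul0r.
rewrite oppe0.
pose m := Num.max a b.
have am : a <= m by rewrite le_max lexx.
have phiE0 x : x < a \/ m < x -> phi x = 0.
  move=> [xa|mx]; apply: phi0; [by left|right].
  by apply: le_lt_trans mx; rewrite le_max lexx orbT.
have d1 x : derivable phi x 1 by have := dphi 0%N x.
have cphi x : {for x, continuous phi}.
  by apply: differentiable_continuous; exact/derivable1_diffP.
have cdphi x : {for x, continuous phi^`()}.
  apply: differentiable_continuous; apply/derivable1_diffP.
  by have := dphi 1%N x.
have m1 : 0 < m + 1 by rewrite ltr_wpDl// (le_trans (ltW a0)).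
have dphi0 x : m < x -> phi^`() x = 0.
  move=> mx; rewrite derive1E.
  rewrite (@near_eq_derive _ _ _ phi (cst 0))//; first exact: derive_cst.
  - by near=> y; apply: phiE0; right; near: y; exact: lt_nbhsr.
rewrite (_ : `[(0:R), +oo[ = `[0, m + 1] `|` `]m + 1, +oo[); last first.
  by rewrite -itv_bndbnd_setU// bnd_simp ltW.
have cgphi : {within `[0, m + 1], continuous (fun t => g 0 i * phi^`()%classic t)}.
  apply: continuous_subspaceT => x.
  by apply: continuousM; [exact: cst_continuous|exact: cdphi].
have tail0 t : `]m + 1, +oo[%classic t -> (g 0 i * phi^`()%classic t)%:E = 0%E.
  rewrite /= in_itv/= andbT => mt.
  by rewrite dphi0 ?mulr0// (le_lt_trans _ mt)// lerDl.
rewrite integral_setU//=; last 2 first.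
- apply/measurable_EFinP; apply: measurable_funM => //.
  apply: measurable_funTS.
  by apply: continuous_measurable_fun => x; exact: cdphi.
- apply/disj_setPS => t [] /=; rewrite !in_itv/= andbT => /andP[_ tm].
  by rewrite ltNge tm.
rewrite [X in (_ + X)%E]integral0_eq// adde0.
rewrite (@continuous_FTC2 _ _ (fun t => g 0 i * phi t))//.
- rewrite (phiE0 0) ?(phiE0 (m + 1)) ?mulr0 ?subee//; last by left.
  by right; rewrite ltrDl.
- split.
  + by move=> x _; apply: derivableM.
  + by apply: cvg_at_right_filter; apply: cvgM; [exact: cvg_cst|exact: cphi].
  + by apply: cvg_at_left_filter; apply: cvgM; [exact: cvg_cst|exact: cphi].
- move=> x _; by rewrite derive1Ml.
Unshelve. all: by end_near. Qed.

Definition cst_test (g : 'rV[R]_n) : W11loc R n :=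
  MkW11loc (loc_integrable_cst g) (loc_integrable_cst 0)
    (weak_derivative_cst g).

End cst_test_function.

(* I is the vector integral over [0,oo) of the functional L.  It is unique
   since dotv is nondegenerate. *)
Definition is_vector_integral (R : realType) (n : nat)
    (L : W11loc R n -> \bar R) (I : 'rV[R]_n) : Prop :=
  forall g : 'rV[R]_n, (dotv I g)%:E = L (cst_test g).

(* Main.v *)
Require Import Defs.
From HB Require Import structures.
From mathcomp Require Import all_boot all_order all_algebra.
From mathcomp Require Import all_classical all_reals all_analysis.
From mathcomp Require Import measurable_realfun.
From mathcomp Require Import lra ring.
Import Order.TTheory GRing.Theory Num.Theory.
Import numFieldNormedType.Exports.
Set Implicit Arguments.
Unset Strict Implicit.
Unset Printing Implicit Defensive.
Local Open Scope ring_scope.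
Local Open Scope classical_set_scope.

(** The proximal path u(t) = u_VM J f t is Lipschitz on the whole line, starts
at f, and is constantly equal to P0 J f beyond some time T. On a constant test
function g the functional phi_VM is therefore minus the integral over [0, oo)
of the inner product of g with u'; by the fundamental theorem of calculus this
is the inner product of g with u(0) - u(T) = f - P0 J f, which is the claim.

Convex part. A finite convex absolutely one-homogeneous J >= 0 is a seminorm.
The minimizer u of the energy at time t satisfies the variational inequality
<f - u, w - u> <= t (J w - J u) for all w ([u_VM_variational]). Adding the
inequalities at two times bounds |u(s) - u(t)|^2 by
|s - t| J(u(s) - u(t)), and J is bounded by a multiple of the norm; this is
[u_VM_lipschitz]. On the orthogonal complement of its nullspace J is a norm,
hence bounded below by a multiple of the ambient norm
([seminorm_coercive_orth]), so that <f - P0 f, w> <= T J w for some T and all w;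
combined with the variational inequality this forces u(t) = P0 f as soon as
t >= T ([u_VM_eventually_P0]).

Calculus part. A K-Lipschitz F on the real line is differentiable almost
everywhere and is the integral of its derivative ([lipschitz_ae_derivative]).
The functions K x + F x and K x - F x are nondecreasing and continuous; their
Stieltjes measures add up to 2 K times the Lebesgue measure, so the first is
absolutely continuous. Its Radon-Nikodym density r then satisfies
F b - F a = \int_a^b (r - K), and Lebesgue differentiation of this integral
identifies F' with r - K almost everywhere.

Finally, the everywhere-defined function u' takes an unspecified value where u
is not differentiable, so its measurability is unclear. This is harmless,
because the integral, being built from a supremum over simple functions, is
blind to null sets even for nonmeasurable integrands
([ae_eq_integral_nonmeasurable]). *)

(** * Integrals of almost everywhere equal functions *)

Section ae_eq_integral_nonmeasurable.
Local Open Scope ereal_scope.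
Context d (T : measurableType d) (R : realType).
Variable mu : {measure set T -> \bar R}.
Import HBNNSimple.

(** A simple function below f, cut off to 0 on the null set, lies below g and
    has kept its integral. *)
Let le_integral_off_null_set (N : set T) (f g : T -> \bar R) :
  measurable N -> mu N = 0 ->
  (forall x, 0 <= f x) -> (forall x, 0 <= g x) ->
  (forall x, ~ N x -> f x <= g x) ->
  \int[mu]_x f x <= \int[mu]_x g x.
Proof.
move=> mN N0 f0 g0 fg; rewrite !ge0_integralTE//.
apply/ge_ereal_sup => _ [h /= hf <-].
have mNc : measurable (~` N) by exact: measurableC.
pose k := proj_nnsfun h mNc.
have kE x : k x = (h \_ (~` N)) x by rewrite /k -mrestrict.
apply: ereal_sup_ubound; exists k.
  move=> x; suff : ((h \_ (~` N)) x)%:E <= g x by rewrite -kE.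
  rewrite patchE; case: ifPn => [|_].
    by rewrite inE => Nx; exact: le_trans (hf x) (fg x Nx).
  exact: g0.
have sE (l : {nnsfun T >-> R}) : sintegral mu l = \int[mu]_x (l x)%:E.
  by rewrite integral_nnsfun// patch_setT.
rewrite !sE; apply: ge0_ae_eq_integral => //.
- by apply/measurable_EFinP.
- by apply/measurable_EFinP.
- by move=> x _; rewrite lee_fin.
- by move=> x _; rewrite lee_fin.
exists N; split => // x kh; apply: contrapT => Nx; apply: kh => _.
by congr EFin; have := kE x; rewrite patchE mem_set// => e; exact: esym.
Qed.

(** The form needed for pointwise derivatives: where the derivative fails to
    exist its value is junk, so no measurability can be assumed. *)
Lemma ae_eq_integral_nonmeasurable (D : set T) (f g : T -> \bar R) :
  {ae mu, forall x, D x -> f x = g x} ->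
  \int[mu]_(x in D) f x = \int[mu]_(x in D) g x.
Proof.
move=> [N [mN N0 fgN]].
have fg x : ~ N x -> (f \_ D) x = (g \_ D) x.
  move=> Nx; rewrite !patchE; case: ifPn => //; rewrite inE => Dx.
  by apply: contrapT => nfg; apply/Nx/fgN => /= /(_ Dx).
rewrite integral_mkcond [RHS]integral_mkcond integralE [RHS]integralE.
by congr (_ - _); apply/eqP; rewrite eq_le; apply/andP; split;
  apply: (le_integral_off_null_set mN N0) => // x /fg;
  rewrite ?funeposE ?funenegE => ->.
Qed.

End ae_eq_integral_nonmeasurable.

(** * The fundamental theorem of calculus for Lipschitz functions *)

Section lipschitz_FTC.
Context {R : realType}.
Notation mu := (@lebesgue_measure R).
Implicit Types (F : R -> R) (K : R).

Definition lipschitz_with {V : normedModType R} K (F : V -> R) :=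
  forall x y, `|F x - F y| <= K * `|x - y|.

Lemma lipschitz_with_oppr K F :
  lipschitz_with K F -> lipschitz_with K (fun x => - F x).
Proof. by move=> FK x y; rewrite -opprD normrN. Qed.

Lemma lipschitz_with_continuous {V : normedModType R} K (F : V -> R) :
  lipschitz_with K F -> continuous F.
Proof.
move=> FK x; apply/cvgrPdist_lt => e e0; near=> y.
apply: le_lt_trans (FK x y) _.
have K1 : 0 < `|K| + 1 by rewrite ltr_wpDl.
apply: (@le_lt_trans _ _ ((`|K| + 1) * `|x - y|)).
  by rewrite ler_wpM2r// (le_trans (ler_norm _))// lerDl.
rewrite -ltr_pdivlMl//; near: y.
by apply: (@cvgr_dist_lt _ _ _ (nbhs x)) => //; rewrite mulr_gt0// invr_gt0.
Unshelve. all: by end_near. Qed.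

Section cumulative_of_lipschitz.
Variables (K : R) (F : R -> R).
Hypothesis FK : lipschitz_with K F.

Let tilt x := K * x + F x.

Let tilt_nd : nondecreasing tilt.
Proof.
move=> x y xy; rewrite /tilt -subr_ge0.
have := FK x y; rewrite (ler0_norm (_ : x - y <= 0)) ?subr_le0//.
have := ler_norm (F x - F y); lra.
Qed.

Let tilt_rc : right_continuous tilt.
Proof.
apply: right_continuousW => x; apply: cvgD.
  by apply: cvgM; [exact: cvg_cst|exact: cvg_id].
exact: (lipschitz_with_continuous FK).
Qed.

Definition cumulative_of_lipschitz : cumulative R R :=
  HB.pack tilt (isCumulative.Build R _ R tilt tilt_nd tilt_rc).

End cumulative_of_lipschitz.

Lemma lebesgue_stieltjes_ocitv (G : cumulative R R) (a b : R) : a <= b ->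
  lebesgue_stieltjes_measure G `]a, b]%classic = (G b - G a)%:E.
Proof.
move=> ab; rewrite /lebesgue_stieltjes_measure /measure_extension.
by rewrite measurable_mu_extE/= ?wlength_itv_bnd//; exact: is_ocitv.
Qed.

(** Adding the Stieltjes measures of K x + F x and K x - F x cancels F and
    leaves 2 K times the Lebesgue measure, which thus dominates each summand. *)
Lemma lipschitz_stieltjes_dominated K F (FK : lipschitz_with K F) : 0 < K ->
  lebesgue_stieltjes_measure (cumulative_of_lipschitz FK) `<< mu.
Proof.
move=> K0; apply/null_content_dominatesP => A mA muA0.
set nuF := lebesgue_stieltjes_measure _.
pose nuN :=
  lebesgue_stieltjes_measure (cumulative_of_lipschitz (lipschitz_with_oppr FK)).
have c0 : 0 <= (2 * K)^-1 by rewrite invr_ge0 mulr_ge0// ltW.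
pose m := mscale (NngNum c0) (measure_add nuF nuN).
have mE X : m X = ((2 * K)^-1%:E * (nuF X + nuN X))%E.
  by rewrite /m /mscale/=; congr (_ * _)%E; exact: measure_addE.
have muE X : ocitv X -> mu X = ((2 * K)^-1%:E * (nuF X + nuN X))%E.
  move=> [[x y] _ <-]/=.
  have [xy|yx] := leP x y; last first.
    rewrite set_itv_ge -?leNgt ?bnd_simp 1?ltW// measure0.
    have -> : nuF set0 = 0%E by exact: measure0.
    have -> : nuN set0 = 0%E by exact: measure0.
    by rewrite adde0 mule0.
  rewrite /nuF /nuN !lebesgue_stieltjes_ocitv// lebesgue_measure_itv/= lte_fin.
  rewrite -EFinD -EFinM.
  have -> : (2 * K)^-1 * (K * y + F y - (K * x + F x)
      + (K * y + - F y - (K * x + - F x))) = y - x.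
    by field; rewrite gt_eqF.
  move: xy; rewrite le_eqVlt => /predU1P[->|->//].
  by rewrite ltxx subrr.
have := @lebesgue_measure_unique R m
  (fun X oX => etrans (muE X oX) (esym (mE X))) A mA.
rewrite muA0 => /esym/(etrans (esym (mE A)))/eqP; rewrite mule_eq0.
rewrite eqe invr_eq0 mulf_eq0 pnatr_eq0/= (gt_eqF K0)/=.
by rewrite padde_eq0 ?measure_ge0// => /andP[/eqP].
Qed.

(** The density h is the Radon-Nikodym derivative of the Stieltjes measure of
    K x + F x, minus the slope K of the tilt. *)
Lemma lipschitz_ae_derivative K F (a b : R) : lipschitz_with K F -> a <= b ->
  exists h : R -> R,
    [/\ mu.-integrable `]a, b] (EFin \o h),
        {ae mu, forall x, `]a, b]%classic x ->
           derivable F x 1 /\ F^`()%classic x = h x} &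
        (\int[mu]_(x in `]a, b]) (h x)%:E = (F b - F a)%:E)%E].
Proof.
wlog K0 : K / 0 < K.
  move=> wlog FK ab; have K1 : 0 < `|K| + 1 by rewrite ltr_wpDl.
  apply: (wlog _ K1) => // x y; apply: le_trans (FK x y) _; rewrite ler_wpM2r//.
  by rewrite (le_trans (ler_norm _))// lerDl.
move=> FK ab; pose G := cumulative_of_lipschitz FK.
(* Restricting to a bounded interval makes the measure finite and its density
   integrable; going up to b + 1 leaves room to differentiate at b itself. *)
have mD : measurable (`]a, b + 1]%classic : set (measurableTypeR R)).
  exact: measurable_itv.
have ab1 : a <= b + 1 by rewrite ler_wpDr.
have GDoo : (lebesgue_stieltjes_measure G `]a, (b + 1)%R]%classic < +oo)%E.
  by rewrite lebesgue_stieltjes_ocitv// ltry.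
pose nu : {finite_measure set (measurableTypeR R) -> \bar R} := mfrestr mD GDoo.
have numu : nu `<< mu.
  apply/null_content_dominatesP => A mA A0.
  have /null_content_dominatesP := lipschitz_stieltjes_dominated FK K0.
  move=> /(_ A mA A0) GA0; apply: (subset_measure0 _ _ _ GA0) => //.
  exact: measurableI.
have icst : mu.-integrable `]a, b]%classic (cst K%:E).
  apply: (@integrableS _ _ _ mu `[a, b]%classic) => //.
    by apply: subset_itvr; rewrite bnd_simp.
  rewrite -[cst _]/(EFin \o cst K).
  apply: continuous_compact_integrable; first exact: segment_compact.
  by apply: continuous_subspaceT => x; exact: cvg_cst.
pose rho := Radon_Nikodym_SigmaFinite.f nu mu.
pose r x := fine (rho x).
have rE : EFin \o r = rho.
  by apply/funext => x /=; rewrite fineK// Radon_Nikodym_SigmaFinite.f_fin_num.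
have ir : mu.-integrable setT (EFin \o r).
  by rewrite rE; exact: Radon_Nikodym_SigmaFinite.f_integrable.
have intr x : a <= x -> x <= b + 1 ->
    (\int[mu]_(t in `]a, x]) (r t)%:E = (G x - G a)%:E)%E.
  move=> ax xb; rewrite -[LHS]/(integral mu _ (EFin \o r)) rE.
  rewrite -Radon_Nikodym_SigmaFinite.f_integral//.
  rewrite -[LHS]/(lebesgue_stieltjes_measure G (_ `&` _)) setIidl.
    by rewrite lebesgue_stieltjes_ocitv.
  by apply: subset_itvl; rewrite bnd_simp.
have irS A : measurable A -> mu.-integrable A (EFin \o r).
  by move=> mA; exact: integrableS ir.
have locr : locally_integrable setT r.
  by apply: open_integrable_locally => //; exact: openT.
have FTC := @FTC1 R r (BRight a) (fun y => irS _ (measurable_itv _)) locr.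
exists (fun x => r x - K); split.
- rewrite (_ : EFin \o _ = (EFin \o r) \- (cst K%:E))%E; last exact/funext.
  by apply: integrableB => //; exact: irS.
- move: FTC; apply: filterS; first exact: (ae_filter_ringOfSetsType mu).
  move=> x + /=; rewrite in_itv/= => + /andP[ax xb].
  move=> /(_ _)[|dI I']; first by rewrite lte_fin.
  set I := (fun y => _) in dI I'.
  have FI : {near x, (fun y => I y - K * (y - a) + F a) =1 F}.
    near=> y; have ay : a < y by near: y; exact: lt_nbhsr.
    have yb : y < b + 1.
      by near: y; apply: lt_nbhsl; rewrite (le_lt_trans xb)// ltrDl.
    rewrite /I /Rintegral intr ?ltW//= /G/=; ring.
  have idI : is_derive x 1 I (r x) by apply: DeriveDef => //; rewrite -derive1E.
  have idF : is_derive x 1 (fun y => I y - K * (y - a) + F a) (r x - K).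
    by apply: is_derive_eq; rewrite subr0 addr0 /GRing.scale/= mulr1.
  have [dF F'] := near_eq_is_derive FI idF.
  by split; rewrite ?derive1E.
- transitivity (\int[mu]_(x in `]a, b]) ((EFin \o r) \- (cst K%:E)) x)%E.
    by apply: eq_integral.
  rewrite integralB//=; last exact: irS.
  rewrite intr//; last by rewrite lerDl.
  have muab : mu `]a, b]%classic = (b - a)%:E.
    rewrite lebesgue_measure_itv/= lte_fin; move: ab; rewrite le_eqVlt.
    by move=> /predU1P[->|->//]; rewrite ltxx subrr.
  rewrite integral_cst// [X in (_ * X)%E]muab.
  by rewrite -EFinM -EFinB; congr EFin; rewrite /G/=; ring.
Unshelve. all: by end_near. Qed.

End lipschitz_FTC.

(** * The Euclidean inner product and the sup norm *)

Section dotv_theory.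
Context {R : realType} {n : nat}.
Implicit Types (u v w : 'rV[R]_n) (a : R).

Lemma dotvC u v : dotv u v = dotv v u.
Proof. by apply: eq_bigr => i _; rewrite mulrC. Qed.

Lemma dotvDl u v w : dotv (u + v) w = dotv u w + dotv v w.
Proof. by rewrite -big_split; apply: eq_bigr => i _; rewrite mxE mulrDl. Qed.

Lemma dotvZl a u w : dotv (a *: u) w = a * dotv u w.
Proof. by rewrite /dotv mulr_sumr; apply: eq_bigr => i _; rewrite mxE mulrA. Qed.

Lemma dotvNl u w : dotv (- u) w = - dotv u w.
Proof. by rewrite -scaleN1r dotvZl mulN1r. Qed.

Lemma dotvDr u v w : dotv w (u + v) = dotv w u + dotv w v.
Proof. by rewrite dotvC dotvDl !(dotvC w). Qed.

Lemma dotvZr a u w : dotv w (a *: u) = a * dotv w u.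
Proof. by rewrite dotvC dotvZl (dotvC w). Qed.

Lemma dotvNr u w : dotv w (- u) = - dotv w u.
Proof. by rewrite dotvC dotvNl (dotvC w). Qed.

Definition dotvE := (dotvDl, dotvDr, dotvNl, dotvNr, dotvZl, dotvZr).

Lemma dotvv_ge0 u : 0 <= dotv u u.
Proof. by apply: sumr_ge0 => i _; rewrite -expr2 sqr_ge0. Qed.

Lemma enorm_sqr u : enorm u ^+ 2 = dotv u u.
Proof. by rewrite /enorm sqr_sqrtr// dotvv_ge0. Qed.

Lemma norm_coord_le u i : `|u 0 i| <= `|u|.
Proof.
rewrite [leRHS]/Num.Def.normr/= mx_normrE.
exact: (@le_bigmax _ _ _ _ (fun i => `|u i.1 i.2|) (0, i)).
Qed.

Lemma sqr_norm_le_dotvv u : `|u| ^+ 2 <= dotv u u.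
Proof.
have [->|u0] := eqVneq `|u| 0; first by rewrite expr0n dotvv_ge0.
have [[j i] /= uE] := mx_norm_neq0 u0.
rewrite [`|u|]uE (ord1 j) real_normK ?num_real// /dotv (bigD1 i)//= -expr2.
by rewrite lerDl sumr_ge0// => k _; rewrite -expr2 sqr_ge0.
Qed.

Lemma dotvv_eq0 u : dotv u u = 0 -> u = 0.
Proof.
move=> u0; have := sqr_norm_le_dotvv u; rewrite u0 => un.
by apply: normr0_eq0; apply/eqP; rewrite -sqrf_eq0 eq_le un sqr_ge0.
Qed.

Lemma dotv_le_norm u w : dotv u w <= (\sum_(i < n) `|u 0 i|) * `|w|.
Proof.
rewrite /dotv mulr_suml ler_sum// => i _; apply: le_trans (ler_norm _) _.
by rewrite normrM ler_wpM2l// norm_coord_le.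
Qed.

Lemma cvg_dotv {T : Type} (H : set_system T) (FH : Filter H)
    (p q : T -> 'rV[R]_n) u v : p @ H --> u -> q @ H --> v ->
  dotv (p x) (q x) @[x --> H] --> dotv u v.
Proof.
move=> pu qv; rewrite /dotv; apply: (@cvg_big R^o _ +%R 0 xpredT _ T H _
  (fun i x => p x 0 i * q x 0 i) (fun i => u 0 i * v 0 i) FH) => [|i _].
  exact: add_continuous.
apply: cvgM.
  exact: (cvg_comp p (fun w : 'rV[R]_n => w 0 i) pu
    (@coord_continuous _ _ _ 0 i u)).
exact: (cvg_comp q (fun w : 'rV[R]_n => w 0 i) qv
  (@coord_continuous _ _ _ 0 i v)).
Qed.

End dotv_theory.

(** * The proximal path of a seminorm *)

(** Convexity at the midpoint of 2 u and 2 v. *)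
Lemma convex_hom_subadditive (R : realType) (n : nat) (J : 'rV[R]_n -> R) :
  @convex_function R 'rV[R]_n setT J -> abs_one_homogeneous J ->
  forall u v, J (u + v) <= J u + J v.
Proof.
move=> Jcvx Jhom u v.
have h0 : (0 : R) <= 2^-1 by rewrite invr_ge0.
have h1 : (2^-1 : R) <= 1 by rewrite invf_le1// ler1n.
have half : 1 - 2^-1 = 2^-1 :> R by lra.
have Jmid : J (2^-1 *: (2 *: u) + (1 - 2^-1) *: (2 *: v)) <=
    2^-1 * J (2 *: u) + (1 - 2^-1) * J (2 *: v).
  exact: (Jcvx (Itv01 h0 h1) (2 *: u) (2 *: v) (in_setT _) (in_setT _)).
move: Jmid; rewrite half !scalerA !mulVf ?pnatr_eq0// !scale1r !Jhom.
by rewrite !normr_nat !mulrA !mulVf ?pnatr_eq0// !mul1r.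
Qed.

Section seminorm.
Context {R : realType} {n : nat}.
Variables (J : 'rV[R]_n -> R).
Hypothesis J_ge0 : forall u, 0 <= J u.
Hypothesis J_hom : abs_one_homogeneous J.
Hypothesis J_sub : forall u v, J (u + v) <= J u + J v.

Lemma seminormN u : J (- u) = J u.
Proof. by rewrite -scaleN1r J_hom normrN normr1 mul1r. Qed.

Lemma seminorm0 : J 0 = 0.
Proof. by have := J_hom 0 0; rewrite scale0r normr0 mul0r. Qed.

Lemma seminormB_le u v : J u - J v <= J (u - v).
Proof. by rewrite lerBlDr -{1}(subrK v u). Qed.

Lemma seminorm_segment u w s : 0 <= s -> s <= 1 ->
  J (u + s *: (w - u)) <= J u + s * (J w - J u).
Proof.
move=> s0 s1; have -> : u + s *: (w - u) = (1 - s) *: u + s *: w.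
  by apply/rowP => i; rewrite !mxE; ring.
apply: le_trans (J_sub _ _) _; rewrite !J_hom ger0_norm ?subr_ge0//.
rewrite ger0_norm//; lra.
Qed.

Definition seminorm_bound := \sum_(i < n) J (delta_mx 0 i).

Lemma seminorm_bound_ge0 : 0 <= seminorm_bound. Proof. exact: sumr_ge0. Qed.

Lemma seminorm_le_norm u : J u <= seminorm_bound * `|u|.
Proof.
rewrite {1}(row_sum_delta u) /seminorm_bound mulr_suml.
apply: (@le_trans _ _ (\sum_(j < n) J (u 0 j *: delta_mx 0 j))).
  elim/big_ind2 : _ => [|x1 x2 y1 y2 h1 h2|i _]; rewrite ?seminorm0//.
  by apply: le_trans (J_sub _ _) _; exact: lerD.
by rewrite ler_sum// => i _; rewrite J_hom mulrC ler_wpM2l// norm_coord_le.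
Qed.

Lemma seminorm_continuous : continuous J.
Proof.
apply: (@lipschitz_with_continuous _ _ seminorm_bound) => u v.
rewrite ler_norml; apply/andP; split.
  rewrite lerNl opprB distrC.
  exact: le_trans (seminormB_le v u) (seminorm_le_norm _).
exact: le_trans (seminormB_le u v) (seminorm_le_norm _).
Qed.

(** First-order optimality: letting s tend to 0 after division by s. *)
Lemma ge0_of_quadratic (a b : R) :
  (forall s, 0 < s -> s <= 1 -> 0 <= s * a + s ^+ 2 * b) -> 0 <= a.
Proof.
move=> h; rewrite leNgt; apply/negP => a0.
(* This step makes s * |b| < - a, so that the linear term wins. *)
have d0 : 0 < `|b| - a by rewrite subr_gt0 (lt_le_trans a0).
pose s := - a / (`|b| - a).
have s0 : 0 < s by rewrite divr_gt0 ?oppr_gt0.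
have s1 : s <= 1 by rewrite ler_pdivrMr// mul1r lerDr.
have := h s s0 s1; rewrite expr2 -mulrA -mulrDr pmulr_rge0// leNgt => /negP.
apply.
apply: (@le_lt_trans _ _ (a + s * `|b|)).
  by rewrite lerD2l ler_wpM2l// ?ler_norm// ltW.
have sd : s * (`|b| - a) = - a by rewrite mulfVK// gt_eqF.
have : s * a < 0 by rewrite pmulr_rlt0.
move: sd; rewrite mulrBr; lra.
Qed.

(** Used with C the whole space and phi = t J for the proximal path, and with C
    the nullspace and phi = 0 for the orthogonal projection onto it. The
    quadratic term makes sublevel sets bounded, hence compact. *)
Lemma proximal_exists (phi : 'rV[R]_n -> R) (C : set 'rV[R]_n)
    (f c : 'rV[R]_n) : continuous phi -> (forall u, 0 <= phi u) ->
  closed C -> C c ->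
  exists2 u, C u & forall w, C w ->
    2^-1 * enorm (u - f) ^+ 2 + phi u <= 2^-1 * enorm (w - f) ^+ 2 + phi w.
Proof.
move=> cphi phi0 clC Cc.
pose E w := 2^-1 * enorm (w - f) ^+ 2 + phi w.
have cE : continuous E.
  have -> : E = fun w => 2^-1 * dotv (w - f) (w - f) + phi w.
    by apply/funext => w; rewrite /E enorm_sqr.
  move=> u; have cwf : w - f @[w --> u] --> u - f.
    exact: (@cvgB R 'rV[R]_n _ (nbhs u) _ id (cst f) u f cvg_id (cvg_cst f)).
  exact: (cvgD (cvgM (cvg_cst _) (cvg_dotv _ cwf cwf)) (cphi u)).
pose A := C `&` E @^-1` [set x | x <= E c].
have clA : closed A.
  apply: closedI => //; apply: preimage_closed; last exact: closed_le.
  by move=> u _; exact: cE.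
have bA : bounded_set A.
  exists (`|f| + 2 * E c + 1); split; first exact: num_real.
  move=> x xE w [_ /= wc]; apply: le_trans (ltW xE).
  rewrite -{1}(subrK f w) (le_trans (ler_normD _ _))// addrC -addrA lerD2l.
  have := sqr_norm_le_dotvv (w - f); move: wc; rewrite {1}/E enorm_sqr.
  have := phi0 w; have := sqr_ge0 (`|w - f| - 1); rewrite sqrrB1.
  nra.
have A0 : A !=set0 by exists c; split => //=.
have [u uA minu] := compact_EVT_min A0 (bounded_closed_compact bA clA)
  (continuous_subspaceT cE).
move: uA; rewrite inE => -[Cu uc]; exists u => // w Cw.
have [wc|cw] := leP (E w) (E c); first by apply: minu; rewrite inE.
exact: le_trans uc (ltW cw).
Qed.

Lemma u_VM_minimizer f t w : 0 < t ->
  VM_energy J f t (u_VM J f t) <= VM_energy J f t w.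
Proof.
move=> t0; rewrite /u_VM t0; case: xgetP => [u _|]; first exact.
have ctJ : continuous (fun u => t * J u).
  by move=> u; exact: (cvgM (cvg_cst t) (@seminorm_continuous u)).
have tJ0 u : 0 <= t * J u by rewrite mulr_ge0// ltW.
have [u _ minu] := proximal_exists f ctJ tJ0 closedT (I : setT 0).
by move=> /(_ u)/= []; move=> v; exact: minu.
Qed.

(** Optimality of the minimizer along the segment towards w. With Num.max t 0 in
    place of t it also covers t <= 0, where u_VM is f, so that the path is
    Lipschitz on the whole line. *)
Lemma u_VM_variational f t w :
  dotv (f - u_VM J f t) (w - u_VM J f t)
    <= Num.max t 0 * (J w - J (u_VM J f t)).
Proof.
have [t0|t0] := leP t 0.
  rewrite mul0r /u_VM ltNge t0/= subrr /dotv big1// => i _.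
  by rewrite mxE mul0r.
set u := u_VM J f t; rewrite -subr_ge0.
apply: (@ge0_of_quadratic _ (2^-1 * dotv (w - u) (w - u))) => s s0 s1.
have := @u_VM_minimizer f t (u + s *: (w - u)) t0.
rewrite -/u /VM_energy !enorm_sqr.
have -> : u + s *: (w - u) - f = (u - f) + s *: (w - u) by rewrite addrAC.
have : t * J (u + s *: (w - u)) <= t * (J u + s * (J w - J u)).
  by rewrite ler_pM2l// seminorm_segment// ltW.
rewrite -(opprB f u); move: (f - u) (w - u) => p q.
rewrite !dotvE (dotvC q p) expr2; lra.
Qed.

(** Adding the variational inequalities of the two points, each tested against
    the other point. *)
Lemma u_VM_lipschitz f s t :
  `|u_VM J f s - u_VM J f t| <= seminorm_bound * `|s - t|.
Proof.
set u := u_VM J f s; set v := u_VM J f t.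
have hu := u_VM_variational f s v; have hv := u_VM_variational f t u.
rewrite -/u -/v in hu hv.
have [->|uv0] := eqVneq `|u - v| 0.
  by rewrite mulr_ge0// seminorm_bound_ge0.
rewrite -(@ler_pM2r _ `|u - v|) ?lt0r ?uv0 ?normr_ge0//.
rewrite -expr2 (le_trans (sqr_norm_le_dotvv _))//.
apply: (@le_trans _ _ ((Num.max s 0 - Num.max t 0) * (J v - J u))).
  have -> : dotv (u - v) (u - v) = dotv (f - u) (v - u) + dotv (f - v) (u - v).
    rewrite -(opprB u v) (_ : f - v = (f - u) + (u - v)).
      by rewrite !dotvE; ring.
    by rewrite addrA subrK.
  by move: hu hv; nra.
apply: le_trans (ler_norm _) _; rewrite normrM.
rewrite -[leRHS]mulrA mulrCA ler_pM//.
  have := ler_norm (s - t); have := ler_norm (t - s).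
  rewrite (distrC t s) ler_norml.
  have [] := leP s 0; have [] := leP t 0 => *; apply/andP; split; lra.
have := seminormB_le u v; have := seminormB_le v u.
have := seminorm_le_norm (u - v); rewrite -(opprB u v) seminormN => h1 h2 h3.
by rewrite distrC ler_norml; apply/andP; split; lra.
Qed.

Lemma closed_nullspace : closed (nullspace J).
Proof.
rewrite (_ : nullspace J = J @^-1` [set x | x = 0])//.
apply: preimage_closed; last exact: closed_eq.
by move=> u _; exact: seminorm_continuous.
Qed.

Lemma nullspaceDZ u w s :
  nullspace J u -> nullspace J w -> nullspace J (u + s *: w).
Proof.
rewrite /nullspace/= => Ju Jw; apply/eqP; rewrite eq_le J_ge0 andbT.
by apply: le_trans (J_sub _ _) _; rewrite J_hom Ju Jw mulr0 addr0.
Qed.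

(** The nearest point of the nullspace to f has an orthogonal residual, because
    the nullspace contains both w and - w. *)
Lemma P0_spec f : nullspace J (P0 J f) /\
  forall w, nullspace J w -> dotv (f - P0 J f) w = 0.
Proof.
rewrite /P0 /orth_proj; case: xgetP => [p _ []//|noproj]; exfalso.
have c0 : continuous (fun _ : 'rV[R]_n => 0 : R) by exact: cst_continuous.
have [p Np minp] :=
  proximal_exists f c0 (fun=> lexx 0) closed_nullspace seminorm0.
have ge0 w : nullspace J w -> 0 <= dotv (p - f) w.
  move=> Nw; apply: (@ge0_of_quadratic _ (2^-1 * dotv w w)) => s _ _.
  have := minp _ (nullspaceDZ s Np Nw); rewrite !addr0 !enorm_sqr.
  rewrite addrAC; move: (p - f) => q.
  rewrite !dotvE (dotvC w q) expr2; lra.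
apply: (noproj p); split => // w Nw; apply/eqP; rewrite eq_le.
rewrite -(opprB p f) dotvNl oppr_le0 ge0//= -dotvNr ge0//.
by rewrite /nullspace/= seminormN.
Qed.

Definition orth_nullspace : set 'rV[R]_n :=
  [set w | forall z, nullspace J z -> dotv w z = 0].

(** On the orthogonal complement of its nullspace J vanishes only at 0, so it
    has a positive minimum on the compact unit sphere there. *)
Lemma seminorm_coercive_orth :
  exists2 c, 0 < c & forall w, orth_nullspace w -> c * `|w| <= J w.
Proof.
pose S := [set w : 'rV[R]_n | `|w| = 1] `&` orth_nullspace.
have normS w : orth_nullspace w -> w != 0 -> S (`|w|^-1 *: w).
  move=> Nw w0; split => /=.
    by rewrite normrZ normfV normr_id mulVf// normr_eq0.
  by move=> z Nz; rewrite dotvZl Nw// mulr0.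
have [S0|/set0P S0] := eqVneq S set0.
  exists 1 => // w Nw; have [->|w0] := eqVneq w 0.
    by rewrite normr0 mulr0.
  by have := normS w Nw w0; rewrite S0.
have clS : closed S.
  apply: closedI.
    apply: (@preimage_closed _ _ (fun w : 'rV[R]_n => `|w|) [set x | x = 1]).
      by move=> w _; exact: norm_continuous.
    exact: closed_eq.
  rewrite (_ : orth_nullspace = \bigcap_(z in nullspace J)
      ((fun w => dotv w z) @^-1` [set x | x = 0])).
    apply: closed_bigI => z _; apply: preimage_closed; last exact: closed_eq.
    move=> w _.
    exact: (@cvg_dotv R n _ (nbhs w) _ id (cst z) w z cvg_id (cvg_cst z)).
  by apply/seteqP; split.
have bS : bounded_set S.
  by exists 1; split; [exact: num_real|move=> x x1 w [/= -> _]; exact: ltW].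
have [v] := compact_EVT_min S0 (bounded_closed_compact bS clS)
  (continuous_subspaceT seminorm_continuous).
rewrite inE => -[/= v1 Nv] minv; exists (J v).
  rewrite lt0r J_ge0 andbT; apply/eqP => Jv.
  have v0 := dotvv_eq0 (Nv v Jv).
  by move/eqP: v1; rewrite v0 normr0 eq_sym oner_eq0.
move=> w Nw; have [->|w0] := eqVneq w 0; first by rewrite normr0 mulr0.
rewrite mulrC -ler_pdivlMl ?normr_gt0//.
have := minv (`|w|^-1 *: w); rewrite inE => /(_ (normS _ Nw w0)).
by rewrite J_hom normfV normr_id.
Qed.

(** Both sides depend only on the component of w orthogonal to the nullspace,
    where J is coercive. *)
Lemma residual_dual_bound f :
  exists2 T, 0 < T & forall w, dotv (f - P0 J f) w <= T * J w.
Proof.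
have [c c0 cJ] := seminorm_coercive_orth; have [_ orthf] := P0_spec f.
set a := f - P0 J f in orthf *; pose A := \sum_(i < n) `|a 0 i|.
have A0 : 0 <= A by exact: sumr_ge0.
exists (A / c + 1); first by rewrite ltr_wpDl// divr_ge0// ltW.
move=> w; have [Nw orthw] := P0_spec w; set w1 := w - P0 J w in orthw.
have wE : w = w1 + P0 J w by rewrite subrK.
rewrite {1}wE dotvDr (orthf _ Nw) addr0 (le_trans (dotv_le_norm _ _))//.
have Jw1 : J w1 <= J w.
  by apply: le_trans (J_sub _ _) _; rewrite seminormN Nw addr0.
rewrite mulrDl mul1r -[leLHS]addr0 lerD// -mulrA ler_wpM2l//.
by rewrite ler_pdivlMl// (le_trans (cJ w1 orthw)).
Qed.

(** For large t the dual bound says that P0 J f satisfies the variational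
    inequality at time t; monotonicity then identifies it with the minimizer. *)
Lemma u_VM_eventually_P0 f :
  exists2 T, 0 < T & forall t, T <= t -> u_VM J f t = P0 J f.
Proof.
have [T T0 bT] := residual_dual_bound f; exists T => // t Tt.
set u := u_VM J f t; set p := P0 J f.
apply/eqP; rewrite -subr_eq0; apply/eqP/dotvv_eq0/eqP.
rewrite eq_le dotvv_ge0 andbT.
have := u_VM_variational f t p; rewrite -/u max_l; last first.
  by rewrite (le_trans _ Tt)// ltW.
have Jp : J p = 0 by have [] := P0_spec f.
rewrite Jp.
have := bT (u - p); have := J_sub u (- p).
rewrite seminormN Jp -/p => h1 h2 h3.
have -> : dotv (u - p) (u - p) = dotv (f - p) (u - p) + dotv (f - u) (p - u).
  rewrite -(opprB u p) (_ : f - p = (f - u) + (u - p)).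
    by rewrite !dotvE; ring.
  by rewrite addrA subrK.
have : T * J (u - p) <= t * J u.
  by apply: ler_pM => //; [exact: ltW|move: h1; rewrite addr0].
move: h2 h3; rewrite sub0r mulrN; lra.
Qed.

End seminorm.

(** * The integral of the derivative of the path *)

Lemma derive1_constant_tail (R : realType) (n : nat) (u : R -> 'rV[R]_n)
    (c : 'rV[R]_n) (T t : R) :
  (forall s, T <= s -> u s = c) -> T < t -> u^`()%classic t = 0.
Proof.
move=> uc Tt; rewrite derive1E (@near_eq_derive _ _ _ u (cst c)).
  exact: derive_cst.
near=> s; apply: uc; apply: ltW; near: s; exact: lt_nbhsr.
Unshelve. all: by end_near. Qed.

(** Being constant after T, the path has zero derivative there, which makes the
    improper integral an integral over a bounded interval. *)
Lemma integral_dot_derive1 (R : realType) (n : nat) (u : R -> 'rV[R]_n)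
    (K T : R) (c g : 'rV[R]_n) : 0 < T ->
  (forall s t, `|u s - u t| <= K * `|s - t|) ->
  (forall s, T <= s -> u s = c) ->
  (\int[@lebesgue_measure R]_(t in `[0%R, +oo[) (dotv g (u^`()%classic t))%:E
     = (dotv g (c - u 0))%:E)%E.
Proof.
move=> T0 uK uc; pose mu := @lebesgue_measure R.
have uiK i : lipschitz_with K (fun t => u t 0 i).
  move=> s t; apply: le_trans (uK s t).
  by have := norm_coord_le (u s - u t) i; rewrite !mxE.
have [h] := choice (fun i => lipschitz_ae_derivative (uiK i) (ltW T0)).
move=> /all_and3[hint hder hFTC].
pose H t := \sum_(i < n) g 0 i * h i t.
transitivity (\int[mu]_(t in `[0%R, +oo[)
    (((fun t => (H t)%:E) \_ `]0%R, T]) t))%E.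
  apply: ae_eq_integral_nonmeasurable.
  (* The densities live on ]0, T], so the endpoint 0 is discarded. *)
  have ae0 : {ae mu, forall t, t != 0}.
    exists [set 0]; split; first exact: measurable_set1.
      exact: lebesgue_measure_set1.
    by move=> t /= /negP/negPn/eqP.
  have : {ae mu, forall t i, `]0%R, T]%classic t ->
      derivable (fun t => u t 0 i) t 1 /\
      (fun t => u t 0 i)^`()%classic t = h i t}.
    by apply: filter_forall; exact: hder.
  move: ae0; apply: filterS2; first exact: (ae_filter_ringOfSetsType mu).
  move=> t t0 ud; rewrite /= in_itv/= andbT => t_ge0.
  have t_gt0 : 0 < t by rewrite lt_neqAle eq_sym t0.
  rewrite patchE.
  case: ifPn => [|]; rewrite ?inE ?notin_setE/= in_itv/= t_gt0/=.
    move=> tT; congr EFin; apply: eq_bigr => i _; congr (_ * _).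
    have ti j : derivable (fun t => u t 0 j) t 1 /\
                (fun t => u t 0 j)^`()%classic t = h j t.
      by apply: ud; rewrite /= in_itv/= t_gt0.
    rewrite -(ti i).2 !derive1E derive_mx ?mxE//.
    by apply/derivable_mxP => k j; rewrite (ord1 k); exact: (ti j).1.
  move=> /negP; rewrite -ltNge => Tt.
  rewrite (derive1_constant_tail uc Tt) /dotv big1// => i _.
  by rewrite mxE mulr0.
rewrite -integral_mkcondr (_ : _ `&` _ = `]0, T]%classic); last first.
  by rewrite setIidr// => t /=; rewrite !in_itv/= andbT => /andP[/ltW].
transitivity (\sum_(i < n) (g 0 i)%:E * \int[mu]_(t in `]0%R, T]) (h i t)%:E)%E.
  have ih i : mu.-integrable `]0%R, T] (fun t => (g 0 i)%:E * (h i t)%:E)%E.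
    by apply: integrableZl => //; exact: hint.
  under eq_integral do rewrite -sumEFin.
  transitivity (\int[mu]_(t in `]0%R, T])
      (\sum_(i < n) (g 0 i)%:E * (h i t)%:E))%E; first by apply: eq_integral.
  rewrite integral_sum//; apply: eq_bigr => i _.
  by rewrite integralZl//; exact: hint.
rewrite /dotv -sumEFin; apply: eq_bigr => i _.
by rewrite hFTC -EFinM uc// !mxE.
Qed.

Theorem theorem2 (R : realType) (n : nat) (J : 'rV[R]_n -> R)
    (J_ge0 : forall u : 'rV[R]_n, 0 <= J u)
    (J_convex : @convex_function R 'rV[R]_n setT J)
    (J_lsc : lower_semicontinuous (EFin \o J))
    (J_hom : abs_one_homogeneous J)
    (f : 'rV[R]_n) :
  exists2 I : 'rV[R]_n,
    is_vector_integral (phi_VM J f) I & f = P0 J f + I.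
Proof.
have J_sub := convex_hom_subadditive J_convex J_hom.
have [T T0 uT] := u_VM_eventually_P0 J_ge0 J_hom J_sub f.
exists (f - P0 J f); last by rewrite addrC subrK.
move=> g; rewrite /phi_VM /=.
under eq_integral do rewrite scaler0 add0r.
rewrite (integral_dot_derive1 _ T0 (u_VM_lipschitz J_ge0 J_hom J_sub f) uT).
rewrite /u_VM ltxx -EFinN; congr EFin.
by rewrite dotvC -dotvNr opprB.
Qed.
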